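(* Consider an instance of $\texttt{SoftCumulative}$ with activity set $A$, current domains $D(\cdot)$, horizon $m$ and limits $ideal\_capa \le max\_capa$. Let $\langle [\delta,\delta'[, sum_h\rangle$ be a rectangle of the cumulated profile, with $0 \le \delta<\delta' \le m$, and let $a \in ActToPrune$ be an activity which has no compulsory part within this rectangle. If $$sum_h + \min(D(res[a])) > ideal\_capa + \max_{t\in[\delta,\delta'[}\bigl(\max(D(costVar[t]))\bigr),$$ then all values in the open interval $]\delta-\min(D(dur[a])),\,\delta'[$ can be removed from $D(start[a])$; that is, no solution of $\texttt{SoftCumulative}$ with respect to the current domains has $start[a] \in\, ]\delta-\min(D(dur[a])),\,\delta'[$.
   Context: Time is discrete: points in time are integers, $[x,y[$ denotes $\{t\in\mathbb{Z}: x\le t<y\}$ and $]x,y[$ denotes $\{t\in\mathbb{Z}: x<t<y\}$. Each variable $x$ is integer-valued with a current finite nonempty domain $D(x)$, with minimum $\min(D(x))$ and maximum $\max(D(x))$. $A=\{a_1,\dots,a_n\}$ is a set of non-preemptive activities scheduled between time $0$ and $m$ (starts and ends lie in $\{0,\dots,m\}$). Each $a\in A$ has variables $start[a]$, $dur[a]$ (duration), $end[a]$ and $res[a]$ (amount of resource consumed, or height). Each activity consumes a positive amount of the resource (durations and heights are positive). For an assignment of the variables, the cumulated height at time $t$ is $h_t=\sum_{a\in A,\ start[a]\le t<end[a]}\min(D(res[a]))$. $\texttt{SoftCumulative}$ has two integer resource limits $ideal\_capa\le max\_capa$ and, for each point in time $t\in\{0,\dots,m-1\}$, an integer variable $costVar[t]$.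 It enforces: (C1) $start[a]+dur[a]=end[a]$ for every $a\in A$; (C2) $h_t\le max\_capa$ for every $t$; (C3) $costVar[t]=\max(0,h_t-ideal\_capa)$ for every $t \in\{0,\dots,m-1\}$. A solution with respect to the current domains is an assignment of each variable to a value of its current domain satisfying C1, C2 and C3. A value $v$ ''can be removed'' from $D(x)$ if no solution assigns $v$ to $x$. The compulsory part of an activity $a$ is nonempty if and only if $\max(D(start[a]))<\min(D(end[a]))$, and then it has height $\min(D(res[a]))$ on $[\max(D(start[a])),\min(D(end[a]))[$ and height $0$ elsewhere. The cumulated profile is the function whose height at time $t$ is $\sum_{a\in A,\ t\in[\max(D(start[a])),\min(D(end[a]))[}\min(D(res[a]))$. A rectangle $\langle[\delta,\delta'[,sum_h\rangle$ of the profile is an interval $[\delta,\delta'[$ on which the set of activities whose compulsory part covers $t$ is the same for all $t$, with $sum_h$ the constant height of the profile on it. $ActToPrune$ is the set of activities whose time window $[\min(D(start[a])),\max(D(end[a]))[$ intersects $[\delta,\delta'[$. Activity $a$ has no compulsory part within the rectangle if its compulsory part is empty or does not intersect $[\delta,\delta'[$. *)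

(* Defs.v *)
From HB Require Import structures.
From mathcomp Require Import all_boot all_order all_algebra finmap.

Set Implicit Arguments.
Unset Strict Implicit.
Unset Printing Implicit Defensive.

Import Order.TTheory GRing.Theory Num.Theory.
Local Open Scope ring_scope.

(* The value on the empty set is the junk value 0. *)
Definition fsmin (D : {fset int}) : int := \big[Order.min/head 0 D]_(x <- D) x.
Definition fsmax (D : {fset int}) : int := \big[Order.max/head 0 D]_(x <- D) x.

Lemma fsmin_le (D : {fset int}) x : x \in D -> fsmin D <= x.
Proof. move=> xD; exact: (@ge_bigmin_seq _ _ _ _ _ x xpredT id). Qed.

Lemma fsmax_ge (D : {fset int}) x : x \in D -> x <= fsmax D.
Proof. move=> xD; exact: (@le_bigmax_seq _ _ _ _ _ x xpredT id). Qed.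

Lemma big_sel_in (op : int -> int -> int) (s : seq int) :
    (forall x y, op x y = x \/ op x y = y) -> s != [::] ->
  \big[op/head 0 s]_(x <- s) x \in s.
Proof.
move=> opP s0; have hs : head 0 s \in s.
  by case: s s0 => [|y s] //= _; rewrite inE eqxx.
rewrite big_seq; apply: (big_ind (fun y => y \in s)) => // x y xs ys.
by case: (opP x y) => ->.
Qed.

Lemma fsmin_in (D : {fset int}) : D != fset0 -> fsmin D \in D.
Proof.
move=> D0; apply: big_sel_in => [x y|].
  by rewrite minEle; case: ifP; [left | right].
by apply: contraNneq D0 => s0; rewrite -cardfs_eq0 s0.
Qed.

Lemma fsmax_in (D : {fset int}) : D != fset0 -> fsmax D \in D.
Proof.
move=> D0; apply: big_sel_in => [x y|].
  by rewrite maxEle; case: ifP; [right | left].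
by apply: contraNneq D0 => s0; rewrite -cardfs_eq0 s0.
Qed.

Record domain := Domain {
  dom_set :> {fset int};
  dom_neq0 : dom_set != fset0
}.

(* A SoftCumulative constraint together with the current domains of its
   variables; costVar is indexed by the time points 0, ..., m - 1. *)
Record instance (A : finType) (m : nat) := Instance {
  ideal_capa : int;
  max_capa : int;
  Dstart : A -> domain;
  Ddur : A -> domain;
  Dend : A -> domain;
  Dres : A -> domain;
  DcostVar : 'I_m -> domain;
  ideal_le_max : ideal_capa <= max_capa;
  start_horizon : forall a x, x \in dom_set (Dstart a) -> 0 <= x <= m%:Z;
  end_horizon : forall a x, x \in dom_set (Dend a) -> 0 <= x <= m%:Z;
  dur_gt0 : forall a x, x \in dom_set (Ddur a) -> 0 < x;
  res_gt0 : forall a x, x \in dom_set (Dres a) -> 0 < x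
}.

Record assignment (A : finType) (m : nat) := Assignment {
  start : A -> int;
  dur : A -> int;
  end_ : A -> int;
  res : A -> int;
  costVar : 'I_m -> int
}.

Section SoftCumulative.
Variables (A : finType) (m : nat) (I : instance A m).

Definition in_domains (s : assignment A m) : Prop :=
  (forall a, [/\ start s a \in dom_set (Dstart I a),
                 dur s a \in dom_set (Ddur I a),
                 end_ s a \in dom_set (Dend I a)
               & res s a \in dom_set (Dres I a)])
  /\ (forall t, costVar s t \in dom_set (DcostVar I t)).

(* The height counted for an activity is the minimum of the domain of its
   resource variable, not the value assigned to that variable. *)
Definition height (s : assignment A m) (t : int) : int :=
  \sum_(a : A | start s a <= t < end_ s a) fsmin (Dres I a).

Definition C1 (s : assignment A m) : Prop :=
  forall a, start s a + dur s a = end_ s a.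

Definition C2 (s : assignment A m) : Prop :=
  forall t : int, height s t <= max_capa I.

Definition C3 (s : assignment A m) : Prop :=
  forall t : 'I_m, costVar s t = Order.max 0 (height s t%:Z - ideal_capa I).

Definition solution (s : assignment A m) : Prop :=
  [/\ in_domains s, C1 s, C2 s & C3 s].

(* A variable is represented by its evaluation map on assignments. *)
Definition can_be_removed (x : assignment A m -> int) (v : int) : Prop :=
  forall s, solution s -> x s <> v.

Definition intersects (i j : interval int) : Prop :=
  exists2 t : int, t \in i & t \in j.

Definition compulsory_part (a : A) : interval int :=
  `[fsmax (Dstart I a), fsmin (Dend I a)[.

Definition profile (t : int) : int :=
  \sum_(a : A | t \in compulsory_part a) fsmin (Dres I a).

Definition rectangle (delta delta' sum_h : int) : Prop :=
  (forall t t', t \in `[delta, delta'[ -> t' \in `[delta, delta'[ ->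
     [set a | t \in compulsory_part a] = [set a | t' \in compulsory_part a])
  /\ (forall t, t \in `[delta, delta'[ -> profile t = sum_h).

Definition ActToPrune (delta delta' : int) (a : A) : Prop :=
  intersects `[fsmin (Dstart I a), fsmax (Dend I a)[ `[delta, delta'[.

Definition no_compulsory_part_within (delta delta' : int) (a : A) : Prop :=
  ~~ (fsmax (Dstart I a) < fsmin (Dend I a))
  \/ ~ intersects (compulsory_part a) `[delta, delta'[.

Definition max_costVar (delta delta' : int) : int :=
  fsmax [fset fsmax (DcostVar I t) | t in 'I_m &
                  (t : 'I_m)%:Z \in `[delta, delta'[]%fset.

End SoftCumulative.

(* Main.v *)
Require Import Defs.
From mathcomp Require Import all_boot all_order all_algebra finmap zify.

Import Order.TTheory GRing.Theory Num.Theory.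
Local Open Scope ring_scope.

(** A start of [a] in the forbidden interval makes [a] run at the point
    [t = max(start a, delta)] of the rectangle. There [a] adds its height to
    the profile, which does not count it, so [h_t - ideal_capa] exceeds every
    value left in the domain of [costVar t]. *)

Lemma compulsory_part_sub {A : finType} {m : nat} {I : instance A m}
    {s : assignment A m} {a : A} {t : int} :
  in_domains I s -> t \in compulsory_part I a -> start s a <= t < end_ s a.
Proof.
case=> /(_ a)[sD _ eD _] _; rewrite in_itv /= => /andP[le_t t_lt].
by rewrite (le_trans (fsmax_ge sD) le_t) (lt_le_trans t_lt (fsmin_le eD)).
Qed.

(** Activities whose compulsory part covers [t] run at [t] under any assignment within the domains,
    and [a] is one more running activity. Positive heights allow dropping all other running
    activities. *)
Lemma profile_add_le_height {A : finType} {m : nat} {I : instance A m}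
    {s : assignment A m} {a : A} {t : int} :
  in_domains I s -> t \notin compulsory_part I a -> start s a <= t < end_ s a ->
  profile I t + fsmin (Dres I a) <= height I s t.
Proof.
move=> sI ta runs.
have res_ge0 b : 0 <= fsmin (Dres I b).
  exact/ltW/(res_gt0 (fsmin_in (dom_neq0 (Dres I b)))).
rewrite /height (bigD1 a runs) /= [leRHS]addrC lerD2r /profile.
rewrite [leLHS]big_mkcond [leRHS]big_mkcond; apply: ler_sum => b _.
case: ifPn => [tb|_]; last by case: ifP.
rewrite (compulsory_part_sub sI tb) /=.
(* The term [b = a] is missing on the right, but [ta] keeps it out of the profile too. *)
by case: eqP => [eq_ba|//]; rewrite -eq_ba tb in ta.
Qed.

Lemma costVar_le_max_costVar {A : finType} {m : nat} {I : instance A m}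
    {s : assignment A m} {delta delta' : int} {t : 'I_m} :
  in_domains I s -> t%:Z \in `[delta, delta'[ ->
  costVar s t <= max_costVar I delta delta'.
Proof.
case=> _ /(_ t) ctD t_in; apply: le_trans (fsmax_ge ctD) _.
by apply: fsmax_ge; apply/imfsetP; exists t.
Qed.

Lemma notin_compulsory_part {A : finType} {m : nat} {I : instance A m}
    {delta delta' : int} {a : A} {t : int} :
  no_compulsory_part_within I delta delta' a -> t \in `[delta, delta'[ ->
  t \notin compulsory_part I a.
Proof.
move=> nocp t_in; apply/negP => ta; case: nocp => [/negP|]; apply.
  by move: ta; rewrite in_itv /= => /andP[]; apply: le_lt_trans.
by exists t.
Qed.

Theorem mainTheorem1 (A : finType) (m : nat) (I : instance A m)
    (delta delta' sum_h : int) (a : A)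
    (rect : rectangle I delta delta' sum_h)
    (delta_ge0 : 0 <= delta) (lt_delta : delta < delta')
    (delta'_le : delta' <= m%:Z)
    (a_prune : ActToPrune I delta delta' a)
    (a_nocp : no_compulsory_part_within I delta delta' a)
    (over : sum_h + fsmin (Dres I a)
            > ideal_capa I + max_costVar I delta delta') :
  forall v : int, v \in `]delta - fsmin (Ddur I a), delta'[ ->
    can_be_removed I (fun s => start s a) v.
Proof.
move=> v; rewrite in_itv /= => /andP[v_gt v_lt] s [sI s1 _ s3] /= sv.
have [_ /fsmin_le dur_ge _ _] := sI.1 a.
have dur_pos : 0 < fsmin (Ddur I a).
  exact: (dur_gt0 (fsmin_in (dom_neq0 (Ddur I a)))).
have [k k_in runs] :
    exists2 k : 'I_m, k%:Z \in `[delta, delta'[ & start s a <= k%:Z < end_ s a.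
  (* As [delta >= 0], the maximum is nonnegative and the absolute value leaves it unchanged. *)
  have ltm : (`|Order.max v delta|%N < m)%N by lia.
  (* If the maximum is [v], [dur_pos] puts it before the end of [a]; if it is [delta], [v_gt]
     does. *)
  by exists (Ordinal ltm); rewrite ?in_itv /= -?s1 ?sv; lia.
have := profile_add_le_height sI (notin_compulsory_part a_nocp k_in) runs.
have := costVar_le_max_costVar sI k_in.
(* By C3 the cost is at least the height minus [ideal_capa I], so the two bounds contradict
   [over]. *)
by rewrite s3 (rect.2 _ k_in); lia.
Qed.
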